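(* Let $(V,\mu)$ and $(E,\tau)$ be positive measure spaces, $M:V\times E\to\mathbb R$ a $(\mu\times\tau)$-measurable function, $wt:E\to\mathbb R$ a $\tau$-measurable function, $I\subseteq\mathbb R$ an interval, and $\varphi:I\to\mathbb R$ a function such that $f(t)=t\varphi(t)$ is convex on $I$. Suppose that: (i) $0<\mu(V)<\infty$; (ii) $0<s=\int_E wt\,d\tau<\infty$; (iii) $\int_{V\times E}|M(v,e)|\,|wt(e)|\,d(\mu\times\tau)<\infty$; (iv) for some real number $c$, $\int_V M(v,e)\,d\mu(v)=c$ for $\tau$-almost all $e\in E$, and $\delta(v)=\int_E M(v,e)\,wt(e)\,d\tau(e)\in I$ for $\mu$-almost all $v\in V$; (v) $\int_{V\times E}|\varphi(\delta(v))|\,|M(v,e)|\,|wt(e)|\,d(\mu\times\tau)<\infty$. Let $\bar\delta=\frac{1}{\mu(V)}\int_V\delta\,d\mu$. Suppose moreover that $f(t)=t\varphi(t)$ is twice continuously differentiable on an interval containing the range of $\delta$ and that, for some constant $\alpha$, $f''(t)\ge\alpha>0$ on that interval. Then \[ \frac1s\int_{V\times E}\varphi(\delta(v))M(v,e)\,wt(e)\,d(\mu\times\tau)-c\,\varphi(\bar\delta)\ \ge\ \frac{\alpha\,\mu(V)}{2s}\operatorname{Var}_{\mathbb P}(X), \] where $\mathbb P$ is the probability measure $d\mathbb P=\frac{1}{\mu(V)}\,d\mu$ on $V$ and $X$ is the random variable $X(v)=\delta(v)$.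
   Context: A positive measure space is a measure space equipped with a positive measure, and $\mu\times\tau$ is the product measure on $V\times E$. All functions and kernels are assumed measurable whenever required, and all stated integrals are assumed to be well defined. Here $\mathbb E_{\mathbb P}[X]=\bar\delta$ and $\operatorname{Var}_{\mathbb P}(X)=\frac{1}{\mu(V)}\int_V(\delta(v)-\bar\delta)^2\,d\mu(v)$. *)

(* Defs.v *)
From HB Require Import structures.
From mathcomp Require Import all_boot all_order all_algebra.
From mathcomp Require Import all_classical all_reals all_analysis.

Set Implicit Arguments.
Unset Strict Implicit.
Unset Printing Implicit Defensive.
Import Order.TTheory GRing.Theory Num.Theory.
Import numFieldNormedType.Exports.

Local Open Scope classical_set_scope.
Local Open Scope ring_scope.

(* The library's [mu \x tau] is a measure only when [tau] is
   sigma-finite.  Here both measures are arbitrary; when they are sigma-finite,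
   [product_measure_unique] says that [pi] is [mu \x tau]. *)
Definition is_product_measure (R : realType) (dV dE : measure_display)
    (V : measurableType dV) (E : measurableType dE)
    (mu : {measure set V -> \bar R}) (tau : {measure set E -> \bar R})
    (pi : {measure set (V * E) -> \bar R}) : Prop :=
  forall (A : set V) (B : set E), measurable A -> measurable B ->
    (pi (A `*` B) = mu A * tau B)%E.

(* Takes the value 0 at those [v] for which the integral is not finite. *)
Definition delta (R : realType) (dV dE : measure_display)
    (V : measurableType dV) (E : measurableType dE)
    (tau : {measure set E -> \bar R}) (M : V * E -> R) (wt : E -> R)
    (v : V) : R :=
  \int[tau]_e (M (v, e) * wt e).

Definition delta_bar (R : realType) (dV dE : measure_display)
    (V : measurableType dV) (E : measurableType dE)
    (mu : {measure set V -> \bar R}) (tau : {measure set E -> \bar R})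
    (M : V * E -> R) (wt : E -> R) : R :=
  (fine (mu setT))^-1 * \int[mu]_v delta tau M wt v.

(* Derivatives are taken relative to [J], hence one-sided at an endpoint of [J]
   that belongs to [J]: values of [f] outside [J] play no role. *)
Definition has_derivative_on (R : realType) (J : set R) (f f' : R -> R) : Prop :=
  forall t, J t ->
    (f u - f t) / (u - t) @[u --> within (J `\ t) (nbhs t)] --> f' t.

Definition C2_on (R : realType) (J : set R) (f f'' : R -> R) : Prop :=
  exists f' : R -> R,
    [/\ has_derivative_on J f f', has_derivative_on J f' f''
      & {within J, continuous f''}].

(* Main.v *)
(* On the interval [J] the function [f t = t * phi t] satisfies
   [f t >= f m + f' m * (t - m) + alpha / 2 * (t - m) ^+ 2].  Taking for [m] the
   mean of [delta] under [P], which lies in [J], and integrating at [t = delta v]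
   gives a Jensen inequality with the variance as remainder.  Fubini turns
   [\int phi(delta) M wt] over [pi] into the integral of [f (delta v)] over [mu],
   and the column condition into [mu(V) * m = c * s].

   Fubini applies to an arbitrary product measure [pi] because the integrands
   vanish off [wt != 0], and [tau] is sigma-finite there since [wt] is
   integrable.  As [delta] lies in [J] only almost everywhere, [phi (delta v)]
   need not be measurable; [delta] is replaced by a function with values in [J]
   that differs from it on a null set. *)

Require Import Defs.
From HB Require Import structures.
From mathcomp Require Import all_boot all_order all_algebra.
From mathcomp Require Import all_classical all_reals all_analysis.
From mathcomp Require Import measurable_realfun ring lra.
Import Order.TTheory GRing.Theory Num.Theory.
Import numFieldNormedType.Exports.
Import HBNNSimple.
Local Open Scope classical_set_scope.
Local Open Scope ring_scope.

Set Implicit Arguments.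
Unset Strict Implicit.
Unset Printing Implicit Defensive.

(** * Derivatives relative to an interval, and the quadratic lower bound *)

Lemma has_derivative_on_continuous (R : realType) (J : set R) (f f' : R -> R) :
  has_derivative_on J f f' -> {within J, continuous f}.
Proof.
move=> df; apply/subspace_continuousP => t Jt.
have /cvgrPdist_lt/(_ _ ltr01) := df t Jt.
rewrite !near_withinE => near1.
have K0 : 0 < `|f' t| + 1 by rewrite ltr_wpDl.
apply/cvgrPdist_lt => e e0; rewrite near_withinE.
have d0 : 0 < e / (`|f' t| + 1) by rewrite divr_gt0.
have neard : \forall u \near t, `|t - u| < e / (`|f' t| + 1).
  exact: (@cvgr_dist_lt _ _ _ _ _ id t cvg_id _ d0).
near=> u => Ju.
have [->|ut] := eqVneq u t; first by rewrite subrr normr0.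
have q1 : `|f' t - (f u - f t) / (u - t)| < 1.
  have : (J `\ t) u -> `|f' t - (f u - f t) / (u - t)| < 1 by near: u.
  by apply; split=> //; exact/eqP.
have ut0 : u - t != 0 by rewrite subr_eq0.
have qK : `|(f u - f t) / (u - t)| < `|f' t| + 1.
  rewrite -[X in `|X|](subrK (f' t)) addrC (le_lt_trans (ler_normD _ _))//.
  by rewrite ltrD2l distrC.
rewrite distrC -(divfK ut0 (f u - f t)) normrM.
have utd : `|u - t| < e / (`|f' t| + 1) by rewrite distrC; near: u.
rewrite (lt_le_trans (ltr_pM _ _ qK utd))// mulrC divfK// gt_eqF.
Unshelve. all: by end_near. Qed.

Lemma has_derivative_on_is_derive (R : realType) (J : set R) (f f' : R -> R)
    (t : R) :
  has_derivative_on J f f' -> (\forall u \near t, J u) ->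
  is_derive t 1 f (f' t).
Proof.
move=> df nJ; have Jt := nbhs_singleton nJ.
suff : h^-1 *: (f (h *: 1 + t) - f t) @[h --> 0^'] --> f' t.
  by move=> fl; apply: DeriveDef; [apply/cvg_ex; exists (f' t)|exact: cvg_lim].
apply/cvgrPdist_lt => e e0.
have /cvgrPdist_lt/(_ _ e0) := df t Jt.
rewrite !near_withinE => ne.
have /nbhs0P : \forall u \near t,
    u != t -> `|f' t - (f u - f t) / (u - t)| < e.
  by apply: filterS2 nJ ne => u Ju + ut; apply; split=> //; exact/eqP.
apply: filterS => h + h0.
rewrite -subr_eq0 addrAC subrr add0r => /(_ h0).
by rewrite [h *: 1]mulr1 [_ *: _]mulrC [h + t]addrC.
Qed.

(** The mean value theorem asks for ordinary derivatives only on []a, b[], whose points are interior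
    to [J]; at [a] and [b], possibly endpoints of [J], continuity relative to [J] suffices. *)
Lemma has_derivative_on_le (R : realType) (J : set R) (f f' : R -> R)
    (a b : R) :
  is_interval J -> has_derivative_on J f f' -> J a -> J b -> a <= b ->
  (forall t, a <= t <= b -> 0 <= f' t) -> f a <= f b.
Proof.
move=> iJ df Ja Jb; rewrite le_eqVlt => /predU1P[-> //|ab] f'0.
have abJ : `[a, b] `<=` J by move=> t /=; rewrite in_itv/=; exact: iJ.
have [t||t tab fE] := @MVT R f f' a b ab.
- move=> tab; apply: has_derivative_on_is_derive df _.
  have : \forall u \near t, u \in `]a, b[ by exact: near_in_itvoo.
  by apply: filterS => u /(@subset_itv_oo_cc _ _ a b u)/abJ.
- apply: continuous_subspaceW abJ _; exact: has_derivative_on_continuous df.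
- rewrite -subr_ge0 fE mulr_ge0 ?subr_ge0 ?(ltW ab)// f'0//.
  by move: tab; rewrite in_itv/= => /andP[/ltW -> /ltW ->].
Qed.

Lemma has_derivative_onB (R : realType) (J : set R) (f f' g g' : R -> R) :
  has_derivative_on J f f' -> has_derivative_on J g g' ->
  has_derivative_on J (f \- g) (f' \- g').
Proof.
move=> df dg t Jt; apply: cvg_trans (cvgB (df t Jt) (dg t Jt)).
apply: near_eq_cvg; apply: nearW => u.
rewrite -[LHS]/((f u - f t) / (u - t) - (g u - g t) / (u - t)) /=; ring.
Qed.

Lemma has_derivative_on_quadratic (R : realType) (J : set R) (k l m : R) :
  has_derivative_on J (fun t => k * (t - m) ^+ 2 + l * (t - m))
                      (fun t => 2 * k * (t - m) + l).
Proof.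
move=> t Jt.
(* For [u != t] the difference quotient at [t] simplifies to this polynomial in [u]. *)
have qcvg : k * (u + t - 2 * m) + l @[u --> t] --> 2 * k * (t - m) + l.
  have -> : 2 * k * (t - m) + l = k * (t + t - 2 * m) + l by ring.
  apply: cvgD; last exact: cvg_cst.
  apply: cvgM; first exact: cvg_cst.
  by apply: cvgD; [apply: cvgD; [exact: cvg_id|exact: cvg_cst]|exact: cvg_cst].
apply: cvg_trans (cvg_within_filter (J `\ t) qcvg).
apply: near_eq_cvg; rewrite near_withinE; apply: nearW => u [_ /eqP ut].
by field; rewrite subr_eq0.
Qed.
Arguments has_derivative_on_quadratic {R} J k l m.

(** Subtracting from [f] the quadratic and linear terms leaves [g] with [g' m = 0] and second
    derivative [f'' - alpha >= 0]. So [g'] is nondecreasing, hence nonpositive left of [m] and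
    nonnegative right of it, and [g] is minimal at [m]. *)
Lemma C2_on_taylor2_ge (R : realType) (J : set R) (f f' f'' : R -> R)
    (alpha m t : R) :
  is_interval J -> has_derivative_on J f f' -> has_derivative_on J f' f'' ->
  (forall u, J u -> alpha <= f'' u) -> J m -> J t ->
  f m + f' m * (t - m) + alpha / 2 * (t - m) ^+ 2 <= f t.
Proof.
move=> iJ df df' af'' Jm Jt.
pose g u := f u - (alpha / 2 * (u - m) ^+ 2 + f' m * (u - m)).
pose g' u := f' u - (2 * (alpha / 2) * (u - m) + f' m).
have dg : has_derivative_on J g g'.
  exact: (has_derivative_onB df
    (has_derivative_on_quadratic J (alpha / 2) (f' m) m)).
have dg' : has_derivative_on J g' (fun u => f'' u - (2 * 0 * (u - m) + alpha)).
  (* With [k = 0] the quadratic is the line [alpha * (u - m)]; the remaining constant [- f' m]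
     cancels in difference quotients. *)
  have := has_derivative_onB df' (has_derivative_on_quadratic J 0 alpha m).
  have -> : g' = (f' \- (fun u => 0 * (u - m) ^+ 2 + alpha * (u - m)))
      \+ cst (- f' m).
    by apply/funext => u; rewrite /g' /=; field.
  move=> h u Ju; apply: cvg_trans (h u Ju).
  by apply: near_eq_cvg; apply: nearW => v /=; ring.
have g'le a b : J a -> J b -> a <= b -> g' a <= g' b.
  move=> Ja Jb ab; apply: (has_derivative_on_le iJ dg') => // u uab.
  by rewrite mulr0 mul0r add0r subr_ge0 af''//; exact: iJ uab.
have g'm : g' m = 0 by rewrite /g' subrr mulr0 add0r subrr.
suff : g m <= g t.
  by rewrite /g subrr expr0n/= !mulr0 addr0 subr0; lra.
have [mt|/ltW tm] := leP m t.
  apply: (has_derivative_on_le iJ dg) => // u /andP[mu ut].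
  by rewrite -g'm; apply: g'le => //; apply: (iJ m t) => //; rewrite mu.
(* Left of [m] it is [- g] that is nondecreasing; it is written as a zero quadratic minus [g] so
   that the difference rule applies. *)
have dNg : has_derivative_on J (fun u => 0 * (u - m) ^+ 2 + 0 * (u - m) - g u)
    (fun u => 2 * 0 * (u - m) + 0 - g' u).
  exact: (has_derivative_onB (has_derivative_on_quadratic J 0 0 m) dg).
suff : - g t <= - g m by rewrite lerN2.
have := has_derivative_on_le iJ dNg Jt Jm tm.
rewrite /= !mul0r !addr0 !sub0r; apply => u /andP[tu um].
rewrite mulr0 mul0r addr0 sub0r oppr_ge0 -g'm; apply: g'le => //.
by apply: (iJ t m) => //; rewrite tu.
Qed.

(** * Jensen's inequality with a variance remainder *)

(** An interval contains everything between two of its points, so it is enough that [X] takes a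
    value on each side of its mean [m]. Otherwise [X - m] would have a strict constant sign and yet
    integrate to 0. *)
Lemma expectation_in_interval (R : realType) (d : measure_display)
    (T : measurableType d) (P : probability T R) (J : set R) (X : T -> R) :
  is_interval J -> P.-integrable setT (EFin \o X) -> (forall x, J (X x)) ->
  J (fine ('E_P[X])%E).
Proof.
move=> iJ iX JX; set m := fine _.
have P0 : P setT <> 0 by rewrite probability_setT => /eqP; rewrite eqe oner_eq0.
have icst r : P.-integrable setT (EFin \o cst r).
  exact: finite_measure_integrable_cst.
have imX : P.-integrable setT (EFin \o (X \- cst m)).
  exact: (integrableB measurableT iX (icst m)).
have EmX : (\int[P]_x (X x - m)%:E = 0)%E.
  rewrite integralB_EFin//; last exact: icst.
  rewrite integral_cst//= probability_setT mule1 /m unlock fineK ?subee//;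
    exact: integrable_fin_num.
(* A nonnegative function with zero integral vanishes almost everywhere; if it is positive
   everywhere, the whole space is null. *)
have Xm0 (Y : T -> R) : measurable_fun setT Y -> (forall x, 0 < Y x) ->
    (\int[P]_x (Y x)%:E <> 0)%E.
  move=> mY Y0 intY.
  have : (\int[P]_x `|(Y x)%:E| = 0)%E.
    rewrite -intY; apply: eq_integral => x _.
    by rewrite gee0_abs// lee_fin ltW.
  move/(ae_eq_integral_abs P measurableT (f := EFin \o Y)).
  have mEY : measurable_fun setT (EFin \o Y) by exact/measurable_EFinP.
  move=> /(_ mEY) [N [mN N0 subN]].
  apply: P0; suff <- : N = setT by [].
  apply/seteqP; split=> // x _; apply: subN => /= /(_ I)/eqP.
  by rewrite eqe gt_eqF.
have mX : measurable_fun setT (X \- cst m).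
  exact/measurable_EFinP/(measurable_int P imX).
have [x [Xx]] : exists x, X x <= m.
  apply: contrapT => /forallNP Xm; apply: (Xm0 _ mX _ EmX) => x /=.
  by rewrite subr_gt0 ltNge; apply/negP/Xm.
have [y Xy] : exists y, m <= X y.
  apply: contrapT => /forallNP Xm; apply: (Xm0 (\- (X \- cst m))).
  - exact: measurableT_comp.
  - by move=> x' /=; rewrite oppr_gt0 subr_lt0 ltNge; apply/negP/Xm.
  - under eq_integral do rewrite /= EFinN.
    by rewrite integralN /= ?EmX ?oppe0// integrable_add_def.
by apply: (iJ (X x) (X y)); rewrite // Xx Xy.
Qed.

(** The quadratic lower bound at the mean is integrated over [P], where the linear term contributes
    0. The variance stays in the extended reals: its finiteness is a consequence of the bound. *)
Lemma jensen_variance (R : realType) (d : measure_display)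
    (T : measurableType d) (P : probability T R) (J : set R) (f f'' : R -> R)
    (alpha : R) (X : T -> R) :
  is_interval J -> C2_on J f f'' -> 0 < alpha ->
  (forall t, J t -> alpha <= f'' t) -> (forall x, J (X x)) ->
  P.-integrable setT (EFin \o X) -> P.-integrable setT (EFin \o (f \o X)) ->
  ((alpha / 2)%:E * 'V_P[X]
     <= ((\int[P]_x f (X x))%R - f (fine ('E_P[X])%E))%R%:E)%E.
Proof.
move=> iJ [f' [df df' _]] a0 af'' JX iX ifX.
have Jm := expectation_in_interval iJ iX JX.
rewrite /variance unlock.
set m := fine ('E_P[X])%E in Jm *.
pose Y x := f (X x) - f m - f' m * (X x - m).
have icst r : P.-integrable setT (EFin \o cst r).
  exact: finite_measure_integrable_cst.
have iXm : P.-integrable setT (EFin \o (X \- cst m)).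
  exact: (integrableB measurableT iX (icst m)).
have iYm : P.-integrable setT (EFin \o (fun x => f' m * (X x - m))).
  exact: (integrableZl measurableT (f' m) iXm).
have ifm : P.-integrable setT (EFin \o (fun x => f (X x) - f m)).
  exact: (integrableB measurableT ifX (icst (f m))).
have iY : P.-integrable setT (EFin \o Y).
  exact: (integrableB measurableT ifm iYm).
have mXm : measurable_fun setT (X \- cst m).
  exact/measurable_EFinP/(measurable_int P iXm).
have intY : \int[P]_x Y x = \int[P]_x f (X x) - f m.
  have cstE r : \int[P]_x (cst r x) = r.
    have PT : fine (P setT) = 1 by rewrite probability_setT.
    by rewrite Rintegral_cst// PT mulr1.
  rewrite (RintegralB measurableT ifm iYm).
  rewrite (RintegralZl (f' m) measurableT iXm).
  rewrite (RintegralB measurableT iX (icst m)).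
  rewrite (RintegralB measurableT ifX (icst (f m))) !cstE.
  by rewrite /m unlock subrr mulr0 subr0.
rewrite unlock -intY /Rintegral fineK; last exact: integrable_fin_num.
rewrite [in leLHS](eq_integral (fun x => ((X x - m) ^+ 2)%:E)); last first.
  by move=> x _; rewrite expr2.
have mX2 : measurable_fun setT (fun x => ((X x - m) ^+ 2)%:E).
  by apply/measurable_EFinP; exact: measurable_funX.
have X2ge0 x : (0 <= ((X x - m) ^+ 2)%:E)%E by rewrite lee_fin sqr_ge0.
have a2 : (0 <= (alpha / 2)%:E)%E by rewrite lee_fin divr_ge0// ltW.
have le_Y x : ((alpha / 2)%:E * ((X x - m) ^+ 2)%:E <= (Y x)%:E)%E.
  rewrite -EFinM lee_fin /Y.
  by have := C2_on_taylor2_ge iJ df df' af'' Jm (JX x); lra.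
rewrite -ge0_integralZl//; apply: ge0_le_integral => //.
- by move=> x _; rewrite mule_ge0.
- exact: measurable_funeM.
- exact: measurable_int iY.
Qed.

(** * Null sets, measurability and rescaled measures *)

(* [f] and [g] may be non-measurable: the simple functions below them, whose
   supremum defines the integral, can be cut off on [N] at no cost. *)
Lemma eq_integral_null_set (R : realType) (d : measure_display)
    (T : measurableType d) (mu : {measure set T -> \bar R}) (N : set T)
    (f g : T -> \bar R) :
  measurable N -> mu N = 0%E -> (forall x, ~ N x -> f x = g x) ->
  (\int[mu]_x f x = \int[mu]_x g x)%E.
Proof.
move=> mN N0 fg.
have ge0 (p q : T -> \bar R) : (forall x, 0 <= q x)%E ->
    (forall x, ~ N x -> p x = q x) ->
    (ereal_sup [set sintegral mu h | h in
       [set h : {nnsfun T >-> R} | forall x, ((h x)%:E <= p x)%E]] <=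
     ereal_sup [set sintegral mu h | h in
       [set h : {nnsfun T >-> R} | forall x, ((h x)%:E <= q x)%E]])%E.
  move=> q0 pq; apply: ge_ereal_sup => _ [h hp <-].
  apply: ereal_sup_ubound.
  exists (proj_nnsfun h (measurableC mN)).
    move=> x; rewrite -mrestrict patchE; case: ifPn => [|_]; last exact: q0.
    by rewrite inE => Nx; rewrite -pq.
  rewrite -mrestrict.
  rewrite -integral_nnsfun//; last exact: measurableC.
  rewrite -integralT_nnsfun// [RHS](ge0_negligible_integral mN)//.
  - by rewrite setTD.
  - by apply/measurable_EFinP.
  - by move=> x _; rewrite lee_fin.
rewrite /integral !patch_setT; congr (_ - _)%E; apply/eqP; rewrite eq_le;
  apply/andP; split; apply: ge0 => // x Nx; by rewrite unlock fg.
Qed.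

(** Dividing by [t] shows [phi] continuous on [J] minus 0. Continuity of [t * phi t] says nothing of
    [phi] at 0, so the event [X x = 0], on which [phi (X x)] is constant, is treated apart. *)
Lemma measurable_fun_mul_id_continuous (R : realType) (d : measure_display)
    (T : measurableType d) (J : set R) (phi : R -> R) (X : T -> R) :
  is_interval J -> {within J, continuous (fun t => t * phi t)} ->
  measurable_fun setT X -> (forall x, J (X x)) ->
  measurable_fun setT (phi \o X).
Proof.
move=> iJ cf mX JX.
have mJ0 : measurable (J `\ 0).
  by apply: measurableD => //; exact: is_interval_measurable.
have mphi : measurable_fun (J `\ 0) phi.
  apply: subspace_continuous_measurable_fun => //.
  apply/subspace_continuousP => t [Jt /eqP t0].
  have -> : phi t = t * phi t / t by rewrite mulrAC divff// mul1r.
  have ft : u * phi u @[u --> within (J `\ 0) (nbhs t)] --> t * phi t.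
    move/subspace_continuousP : cf => /(_ t Jt).
    by apply: cvg_trans; apply: cvg_app; exact: within_subset.
  have It : u^-1 @[u --> within (J `\ 0) (nbhs t)] --> t^-1.
    by apply: cvg_within_filter; apply: cvgV => //; exact: cvg_id.
  apply: cvg_trans (cvgM ft It).
  apply: near_eq_cvg; rewrite near_withinE; apply: nearW => u [_ /eqP u0].
  by rewrite -[LHS]/(u * phi u / u) mulrAC divff// mul1r.
rewrite (_ : phi \o X = fun x => if X x == 0 then phi 0 else phi (X x));
  last first.
  by apply/funext => x /=; case: eqP => // ->.
apply: measurable_fun_if => //.
  by apply: measurable_fun_eqr => //; exact: measurable_cst.
apply: (measurable_comp mJ0 _ mphi).
  by move=> _ [x [_ /= X0] <-]; split=> //; exact/eqP/negbT.
exact: measurable_funTS.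
Qed.

Lemma ae_eq_integrable (R : realType) (d : measure_display)
    (T : measurableType d) (mu : {measure set T -> \bar R})
    (f g : T -> \bar R) :
  mu.-integrable setT f -> measurable_fun setT g -> ae_eq mu setT f g ->
  mu.-integrable setT g.
Proof.
move=> /integrableP[mf foo] mg fg; apply/integrableP; split=> //.
rewrite -(@ge0_ae_eq_integral _ _ _ mu _ (abse \o f))//.
- exact: measurableT_comp.
- exact: measurableT_comp.
- by move=> x _ /=.
- case: fg => N [mN N0 fgN]; exists N; split=> // x nfg.
  by apply: fgN => /= fgx; apply: nfg => /= /fgx ->.
Qed.

(** Used to pass from [mu] to [P]. Nonnegative functions are integrated against [mscale], which
    agrees with [nu] on measurable sets; positive and negative parts give the rest. *)
Lemma integral_scaled_measure (R : realType) (d : measure_display)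
    (T : measurableType d) (mu nu : {measure set T -> \bar R}) (k : R)
    (f : T -> \bar R) :
  0 <= k -> (forall A, measurable A -> nu A = (k%:E * mu A)%E) ->
  mu.-integrable setT f ->
  nu.-integrable setT f /\ (\int[nu]_x f x = k%:E * \int[mu]_x f x)%E.
Proof.
move=> k0 nuE imf; have /integrableP[mf foo] := imf.
have ge0 (g : T -> \bar R) : measurable_fun setT g -> (forall x, 0 <= g x)%E ->
    (\int[nu]_x g x = k%:E * \int[mu]_x g x)%E.
  move=> mg g0; rewrite -(ge0_integral_mscale mu measurableT (NngNum k0))//.
  by apply: eq_measure_integral => A mA _; rewrite nuE.
split.
  apply/integrableP; split=> //.
  rewrite ge0//; last exact: measurableT_comp.
  by rewrite lte_mul_pinfty.
rewrite integralE [in RHS]integralE !ge0//; last 2 first.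
- exact: measurable_funeneg.
- exact: measurable_funepos.
by rewrite [in RHS]muleBr//; exact: integrable_add_def.
Qed.

(** * Fubini for an integrand supported over a sigma-finite set *)

Lemma integral_mrestr_support (R : realType) (d : measure_display)
    (T : measurableType d) (mu : {measure set T -> \bar R}) (D : set T)
    (mD : measurable D) (f : T -> \bar R) :
  (forall x, ~ D x -> f x = 0%E) ->
  (\int[mrestr mu mD]_x f x = \int[mu]_x f x)%E.
Proof.
move=> f0; have <- : f \_ D = f.
  apply/funext => x; rewrite patchE; case: ifPn => // /negP xD.
  by rewrite f0//; apply: contra_not xD; rewrite inE.
rewrite -!integral_mkcond; apply: eq_measure_integral => A mA AD.
by rewrite /= /mrestr setIidl.
Qed.

(** The support is the union of the sets where [|w| >= 1/(n+1)], each of finite measure by Markov's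
    inequality. *)
Lemma sigma_finite_support_integrable (R : realType) (d : measure_display)
    (T : measurableType d) (mu : {measure set T -> \bar R}) (w : T -> R) :
  mu.-integrable setT (EFin \o w) -> sigma_finite [set x | w x != 0] mu.
Proof.
move=> iw; have mw : measurable_fun setT w.
  exact/measurable_EFinP/(measurable_int mu iw).
exists (fun n => [set x | (n.+1%:R^-1)%:E <= `|(w x)%:E|]%E).
  apply/seteqP; split=> [x /= wx|x [n _ /=]].
    have wx0 : 0 < `|w x| by rewrite normr_gt0.
    have [n _ /(_ n (leqnn n)) nw] := near_infty_natSinv_lt (PosNum wx0).
    by exists n => //=; rewrite lee_fin ltW.
  by rewrite lee_fin -normr_gt0; apply: lt_le_trans; rewrite invr_gt0.
move=> n; have n0 : 0 < n.+1%:R^-1 :> R by rewrite invr_gt0.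
split.
  rewrite -[X in measurable X]setTI; apply: emeasurable_fun_c_infty => //.
  by apply: measurableT_comp => //; exact/measurable_EFinP.
have := @le_integral_comp_abse _ _ _ mu _ measurableT (EFin \o w) _ id
  (@measurable_id _ _ _) (fun r r0 => r0) (fun x y _ _ xy => xy)
  (measurable_int mu iw) n0.
rewrite setTI => le_w; have /integrableP[_ woo] := iw.
have : (n.+1%:R^-1%:E * mu [set x | n.+1%:R^-1%:E <= `|(w x)%:E|] < +oo)%E.
  exact: le_lt_trans le_w woo.
rewrite [(mu _ < _)%E]lt_neqAle leey andbT; apply: contraTneq => ->.
by rewrite gt0_muley ?lte_fin// ltxx.
Qed.

(* A copy of [mu] on which the sigma-finite structure can be declared. *)
Definition sigma_finite_alias (R : realType) (d : measure_display)
    (T : measurableType d) (mu : {measure set T -> \bar R})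
    (_ : sigma_finite setT mu) : set T -> \bar R := mu.

HB.instance Definition _ (R : realType) (d : measure_display)
    (T : measurableType d) (mu : {measure set T -> \bar R})
    (h : sigma_finite setT mu) :=
  Measure.on (sigma_finite_alias h).

HB.instance Definition _ (R : realType) (d : measure_display)
    (T : measurableType d) (mu : {measure set T -> \bar R})
    (h : sigma_finite setT mu) :=
  Measure_isSigmaFinite.Build d T R (sigma_finite_alias h) h.

(** The restriction of [tau] to [S] is sigma-finite, and by uniqueness its product with [mu] is the
    restriction of [pi] to [V * S]. As [f] vanishes off that strip, restricting changes none of the
    integrals. *)
Lemma fubini_sigma_finite_support (R : realType) (dV dE : measure_display)
    (V : measurableType dV) (E : measurableType dE)
    (mu : {measure set V -> \bar R}) (tau : {measure set E -> \bar R})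
    (pi : {measure set (V * E) -> \bar R}) (S : set E) (f : V * E -> \bar R) :
  is_product_measure mu tau pi -> (mu setT < +oo)%E ->
  measurable S -> sigma_finite S tau -> (forall v e, ~ S e -> f (v, e) = 0%E) ->
  pi.-integrable setT f ->
  [/\ mu.-integrable setT (fun v => \int[tau]_e f (v, e))%E,
      measurable_fun setT (fun e => \int[mu]_v f (v, e))%E,
      {ae mu, forall v, tau.-integrable setT (fun e => f (v, e))},
      (\int[pi]_z f z = \int[mu]_v \int[tau]_e f (v, e))%E
    & (\int[pi]_z f z = \int[tau]_e \int[mu]_v f (v, e))%E].
Proof.
move=> hpi muoo mS sfS f0 ipf.
have sfmu : sigma_finite setT mu.
  by exists (fun=> setT); [rewrite bigcup_const|].
have sftauS : sigma_finite setT (mrestr tau mS).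
  have [F SF Foo] := sfS.
  (* Adjoining the complement of [S] makes the sets cover [E] and adds no mass, since the restricted
     measure ignores it. *)
  exists (fun n => F n `|` ~` S).
    apply/seteqP; split=> // e _; have [|Se] := pselect (S e).
      by rewrite SF => -[n _ Fne]; exists n => //; left.
    by exists 0%N => //; right.
  move=> n; have [mFn Fnoo] := Foo n; split.
    by apply: measurableU => //; exact: measurableC.
  rewrite /mrestr setIUl setICl setU0.
  apply: le_lt_trans Fnoo; apply: le_measure; rewrite ?inE//.
  exact: measurableI.
pose m1 : {sigma_finite_measure set V -> \bar R} := sigma_finite_alias sfmu.
pose m2 : {sigma_finite_measure set E -> \bar R} := sigma_finite_alias sftauS.
have mVS : measurable ([set: V] `*` S) by exact: measurableX.
have m12 A : measurable A -> (m1 \x m2)%E A = mrestr pi mVS A.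
  apply: product_measure_unique => X Y mX mY.
  rewrite /= /mrestr -setXI setIT hpi//; exact: measurableI.
have f0' z : ~ ([set: V] `*` S) z -> f z = 0%E.
  by case: z => v e /= VS; apply: f0 => Se; exact: VS.
have mf := measurable_int pi ipf.
have int12 (g : V * E -> \bar R) :
    (forall z, ~ ([set: V] `*` S) z -> g z = 0%E) ->
    (\int[m1 \x m2]_z g z = \int[pi]_z g z)%E.
  move=> g0; rewrite -(integral_mrestr_support pi mVS g0).
  by apply: eq_measure_integral => A mA _; exact: m12.
have if12 : (m1 \x m2)%E.-integrable setT f.
  apply/integrableP; split=> //.
  rewrite int12; first by case/integrableP : ipf.
  by move=> z /f0' ->; rewrite abse0.
have int2 v : (\int[m2]_e f (v, e) = \int[tau]_e f (v, e))%E.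
  by apply: integral_mrestr_support => e /f0.
split.
- apply: eq_integrable (integrable_fubini_F if12) => // v _.
  exact: int2.
- exact: (measurable_fubini_G if12).
- apply: filterS (ae_integrable1 if12) => v /integrableP[mfv foo].
  apply/integrableP; split=> //; rewrite -(integral_mrestr_support tau mS)//.
  by move=> e /f0 ->; rewrite abse0.
- rewrite -int12// -integral12_prod_meas1//.
  by apply: eq_integral => v _; exact: int2.
- rewrite -int12// -integral21_prod_meas1//.
  apply: integral_mrestr_support => e Se.
  by apply: integral0_eq => v _; exact: f0.
Qed.

(** * From the product space to Jensen's inequality over [P] *)

Theorem proposition2p8 (R : realType) (dV dE : measure_display)
  (V : measurableType dV) (E : measurableType dE)
  (mu : {measure set V -> \bar R}) (tau : {measure set E -> \bar R})
  (pi : {measure set (V * E) -> \bar R}) (hpi : is_product_measure mu tau pi)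
  (M : V * E -> R) (hM : measurable_fun setT M)
  (wt : E -> R) (hwt : measurable_fun setT wt)
  (I : set R) (hI : is_interval I)
  (phi : R -> R)
  (hconvex : convex_function I (fun t : R => t * phi t : R^o))
  (h_i : (0 < mu setT < +oo)%E)
  (s : R) (hs : (\int[tau]_e (wt e)%:E)%E = s%:E) (h_ii : 0 < s)
  (h_iii : (\int[pi]_z (`|M z| * `|wt z.2|)%:E < +oo)%E)
  (c : R)
  (h_iv_c : {ae tau, forall e : E, (\int[mu]_v (M (v, e))%:E)%E = c%:E})
  (h_iv_I : {ae mu, forall v : V, I (delta tau M wt v)})
  (h_v : (\int[pi]_z (`|phi (delta tau M wt z.1)| * `|M z| * `|wt z.2|)%:E
            < +oo)%E)
  (J : set R) (hJ : is_interval J) (hJI : J `<=` I)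
  (h_range : {ae mu, forall v : V, J (delta tau M wt v)})
  (f'' : R -> R) (hC2 : C2_on J (fun t : R => t * phi t) f'')
  (alpha : R) (halpha : 0 < alpha) (hf'' : forall t, J t -> alpha <= f'' t)
  (P : probability V R)
  (hP : forall A : set V, measurable A ->
          P A = (((fine (mu setT))^-1)%:E * mu A)%E) :
  (((alpha * fine (mu setT)) / (2 * s))%:E * 'V_P[delta tau M wt]
   <= (s^-1 * (\int[pi]_z (phi (delta tau M wt z.1) * M z * wt z.2))%R
       - c * phi (delta_bar mu tau M wt))%R%:E)%E.
Proof.
have /andP[muT0 muToo] := h_i.
have muTfin : mu setT \is a fin_num by rewrite ge0_fin_numE.
set muV := fine (mu setT) in hP *.
have muV0 : 0 < muV by rewrite fine_gt0// muT0.
set dl := delta tau M wt in h_iv_I h_v h_range *.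
pose S : set E := [set e | wt e != 0].
pose F (z : V * E) : R := M z * wt z.2.
(* A finite integral forces integrability: it is the difference of the integrals of the positive and
   negative parts, and [+oo - +oo] is [-oo]. *)
have iwt : tau.-integrable setT (EFin \o wt).
  apply/integrableP; split; first exact/measurable_EFinP.
  by rewrite integral_fin_num_abs// hs.
have sfS : sigma_finite S tau := sigma_finite_support_integrable iwt.
have mS : measurable S.
  by have [A -> mA] := sfS; apply: bigcupT_measurable => n; case: (mA n).
have mwt2 : measurable_fun setT (fun z : V * E => wt z.2).
  exact: measurableT_comp.
have mF : measurable_fun setT F by exact: measurable_funM.
have F0 v e : ~ S e -> F (v, e) = 0.
  by rewrite /S/= /F/= => /negP/negPn/eqP ->; rewrite mulr0.
have iF : pi.-integrable setT (EFin \o F).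
  apply/integrableP; split; first exact/measurable_EFinP.
  by under eq_integral do rewrite /= normrM.
have F0E v e : ~ S e -> (EFin \o F) (v, e) = 0%E by move=> /(F0 v) /= ->.
have [iD mG aeD piD piG] := fubini_sigma_finite_support hpi muToo mS sfS F0E iF.
have dlE v : dl v = fine (\int[tau]_e (EFin \o F) (v, e))%E by [].
have mdl : measurable_fun setT dl.
  apply: (measurableT_comp (fine_measurable measurableT)).
  exact: measurable_int iD.
(* [dl] applies [fine] to the inner integral, so the two agree only where that integral is finite;
   Fubini gives this almost everywhere. *)
have aedl : {ae mu, forall v, (\int[tau]_e (EFin \o F) (v, e))%E = (dl v)%:E}.
  apply: filterS (integrable_ae measurableT iD) => v /(_ Logic.I) fin.
  by rewrite dlE fineK.
have aedlE : ae_eq mu setT (fun v => \int[tau]_e (EFin \o F) (v, e))%E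
    (EFin \o dl).
  by apply: filterS aedl => v /= -> _.
have mEdl : measurable_fun setT (EFin \o dl) by exact/measurable_EFinP.
have idl : mu.-integrable setT (EFin \o dl) := ae_eq_integrable iD mEdl aedlE.
(* Exchanging the order of integration puts the column integrals, almost all equal to [c], inside;
   [wt] then contributes [s]. *)
have intdl : (\int[mu]_v (dl v)%:E = (c * s)%:E)%E.
  rewrite -(ae_eq_integral _ _ measurableT (measurable_int mu iD) mEdl aedlE).
  rewrite -piD piG.
  rewrite (ae_eq_integral (fun e => c%:E * (wt e)%:E)%E _ measurableT mG).
  - by rewrite integralZl// hs EFinM.
  - by apply: measurable_funeM; exact/measurable_EFinP.
  apply: filterS h_iv_c => e he _.
  have mMe : measurable_fun setT (fun v => M (v, e)) by exact: measurableT_comp.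
  have iMe : mu.-integrable setT (EFin \o (fun v => M (v, e))).
    apply/integrableP; split; first exact/measurable_EFinP.
    by rewrite integral_fin_num_abs// he.
  rewrite -he -(integralZr measurableT iMe (wt e)).
  by apply: eq_integral => v _; rewrite /= EFinM.
pose N := dl @^-1` (~` J).
have mN : measurable N.
  rewrite -[N]setTI; apply: mdl => //; apply: measurableC.
  exact: is_interval_measurable.
have N0 : mu N = 0%E by apply/negligibleP.
have [v0 Nv0] : exists v, ~ N v.
  apply: contrapT => /forallNP NT; have := muT0.
  suff -> : [set: V] = N by rewrite N0 ltxx.
  by apply/seteqP; split=> // v _; exact: contrapT (NT v).
have Jv0 : J (dl v0) by exact: contrapT.
(* On the null set [N] the value is replaced by one lying in [J]; a suitable [v0] exists because
   [mu] is not zero. *)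
pose dl1 v := if v \in N then dl v0 else dl v.
have dl1E v : ~ N v -> dl1 v = dl v.
  by rewrite /dl1; case: ifPn => //; rewrite inE.
have Jdl1 v : J (dl1 v).
  by rewrite /dl1; case: ifPn => // /negP; rewrite inE => /contrapT.
have mdl1 : measurable_fun setT dl1.
  apply: measurable_fun_ifT => //; apply: (measurable_fun_bool true).
  rewrite setTI (_ : _ @^-1` _ = N)//.
  by apply/seteqP; split=> v /=; [move/set_mem|move/mem_set].
have ae1 : ae_eq mu setT (EFin \o dl) (EFin \o dl1).
  exists N; split=> // v; apply: contra_notP => Nv /= _.
  by rewrite dl1E.
have idl1 : mu.-integrable setT (EFin \o dl1).
  by apply: (ae_eq_integrable idl _ ae1); exact/measurable_EFinP.
have mphi : measurable_fun setT (phi \o dl1).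
  have [f' [df _ _]] := hC2.
  have cf := has_derivative_on_continuous df.
  exact: measurable_fun_mul_id_continuous hJ cf mdl1 Jdl1.
pose g1 z := phi (dl1 z.1) * F z.
have mNE : measurable (N `*` [set: E]) by exact: measurableX.
(* The convention [0 * +oo = 0] makes this strip null even when [tau] is infinite. *)
have NE0 : pi (N `*` [set: E]) = 0%E by rewrite hpi// N0 mul0e.
have notNE z : ~ (N `*` [set: E]) z -> dl1 z.1 = dl z.1.
  by move=> Nz; apply: dl1E => Nz1; exact: Nz.
have mg1 : measurable_fun setT g1.
  by apply: measurable_funM => //; exact: (measurableT_comp mphi).
have ig1 : pi.-integrable setT (EFin \o g1).
  apply/integrableP; split; first exact/measurable_EFinP.
  rewrite (eq_integral_null_set mNE NE0
    (g := fun z => (`|phi (dl z.1)| * `|M z| * `|wt z.2|)%:E))//.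
  by move=> z /notNE dlz /=; rewrite /g1 dlz /F !normrM mulrA.
have intg1 : \int[pi]_z (phi (dl z.1) * M z * wt z.2) =
    fine (\int[pi]_z (g1 z)%:E)%E.
  congr fine; apply: (eq_integral_null_set mNE NE0) => z /notNE dlz.
  by rewrite /g1 dlz mulrA.
have g10 v e : ~ S e -> (EFin \o g1) (v, e) = 0%E.
  by move=> /(F0 v) F0e; rewrite /= /g1 F0e mulr0.
have [iD1 _ _ piD1 _] := fubini_sigma_finite_support hpi muToo mS sfS g10 ig1.
pose f t := t * phi t.
have mf1 : measurable_fun setT (EFin \o (f \o dl1)).
  by apply/measurable_EFinP; exact: measurable_funM.
(* For fixed [v] the factor [phi (dl1 v)] is constant in [e] and leaves the inner integral, whose
   remainder is [dl v]; their product is [f (dl1 v)] off [N]. *)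
have aef1 : ae_eq mu setT (fun v => \int[tau]_e (EFin \o g1) (v, e))%E
    (EFin \o (f \o dl1)).
  have aeN : {ae mu, forall v, ~ N v}.
    by exists N; split=> // v /contrapT.
  apply: filterS3 aeD aedl aeN => v iFv Fv Nv _.
  rewrite -[LHS]/(\int[tau]_e ((phi (dl1 v))%:E * (EFin \o F) (v, e)))%E.
  by rewrite integralZl// Fv /= -EFinM mulrC dl1E.
have if1 := ae_eq_integrable iD1 mf1 aef1.
have intf1 : (\int[pi]_z (g1 z)%:E = \int[mu]_v (f (dl1 v))%:E)%E.
  rewrite [LHS]piD1; apply: ae_eq_integral aef1 => //.
  exact: measurable_int iD1.
have k0 : 0 <= muV^-1 by rewrite invr_ge0 ltW.
have [iPdl1 PdlE] := integral_scaled_measure k0 hP idl1.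
have [iPf1 PfE] := integral_scaled_measure k0 hP if1.
have PN0 : P N = 0%E by rewrite hP// N0 mule0.
(* The mean of [dl] under [P], by [intdl]. *)
pose m := muV^-1 * (c * s).
have Edl1 : (\int[P]_v (dl1 v)%:E = m%:E)%E.
  rewrite [LHS]PdlE EFinM -intdl; congr (_ * _)%E.
  by apply: (eq_integral_null_set mN N0) => v Nv /=; rewrite dl1E.
have mE : delta_bar mu tau M wt = m by rewrite /delta_bar /Rintegral intdl.
have VE : ('V_P[dl] = 'V_P[dl1])%E.
  have Eeq : ('E_P[dl] = 'E_P[dl1])%E.
    rewrite unlock; apply: (eq_integral_null_set mN PN0) => v Nv.
    by rewrite dl1E.
  rewrite /variance !covariance.unlock Eeq unlock.
  apply: (eq_integral_null_set mN PN0) => v Nv.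
  by rewrite /GRing.mul/= dl1E.
have jensen := jensen_variance hJ hC2 halpha hf'' Jdl1 iPdl1 iPf1.
rewrite mE VE intg1 intf1.
have Em : fine ('E_P[dl1])%E = m by rewrite unlock Edl1.
set B := fine (integral mu _ _).
have PB : \int[P]_v f (dl1 v) = muV^-1 * B.
  by rewrite /Rintegral [X in fine X]PfE fineM//; exact: integrable_fin_num.
move: jensen; rewrite [Rintegral _ _ _]PB Em => jensen.
(* Jensen's inequality is multiplied by [muV / s]; since [m * muV / s = c], the term [m * phi m]
   becomes [c * phi m]. *)
have ms0 : 0 < muV / s by rewrite divr_gt0.
have -> : alpha * muV / (2 * s) = muV / s * (alpha / 2).
  by field; rewrite gt_eqF.
have -> : s^-1 * B - c * phi m = muV / s * (muV^-1 * B - m * phi m).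
  by rewrite /m; field; rewrite !gt_eqF.
by rewrite !EFinM -muleA lee_pmul2l// lte_fin.
Qed.
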